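(* Let $P_1,P_2,\dots,P_N\in\mathcal{RH}_\infty^{m\times m}$. The negative feedback interconnection of the cascade $P_1P_2\cdots P_N$ is stable if there exist functions $\theta_i(\omega)\in\mathbb{R}$, $i=1,2,\dots,N$, such that for all $\omega\in[0,\infty]$, $$[-\infty,-1]\cap\prod_{i=1}^N\mathrm{SRG}_{\theta_i(\omega)}(\mathcal{P}_i(j\omega))=\emptyset,$$ where each $\mathcal{P}_i(j\omega)\subset\mathbb{C}^{m\times m}$ is an arbitrary matrix set containing $P_i(j\omega)$, and, for each $\omega$, at least $N-1$ of the $\mathcal{P}_i(j\omega)$ satisfy the $\theta_i(\omega)$-arc property.
   Context: $\mathcal{RH}_\infty^{m\times m}$ is the set of $m\times m$ real rational proper stable transfer matrices. The feedback interconnection of the cascade (the signal passes through $P_N,\dots,P_2,P_1$ in this order and the output of $P_1$ is fed back with a minus sign to the input of $P_N$; all $P_i\in\mathcal{RH}_\infty^{m\times m}$) is stable if and only if $(I+P_1P_2\cdots P_N)^{-1}\in\mathcal{RH}_\infty^{m\times m}$. $j$ is the imaginary unit, $\langle x,y\rangle=x^Hy$, $\|\cdot\|$ the Euclidean norm. For $x,y\in\mathbb{C}^m$ and $\theta\in\mathbb{R}$, $\angle_\theta(x,y)\in[0,\pi]$ is $\arccos\frac{\mathrm{Re}\langle x,e^{-j\theta}y\rangle}{\|x\|\|y\|}$ if $x\neq0,y\neq0$, and $0$ if $x=0$ or $y=0$. The $\theta$-symmetric scaled relative graph of $C\in\mathbb{C}^{m\times m}$ is $$\mathrm{SRG}_\theta(C)=\Big\{\tfrac{\|Cx\|}{\|x\|}\exp\{j(\theta\pm\angle_\theta(x,Cx))\}:0\neq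 x\in\mathbb{C}^m\Big\}$$ (both signs included), and for a set of matrices $\mathcal{C}$, $\mathrm{SRG}_\theta(\mathcal{C})=\bigcup_{C\in\mathcal{C}}\mathrm{SRG}_\theta(C)$. For $z\in\mathbb{C}$ written $z=|z|e^{j(\theta\pm\psi)}$ with $\psi\in[0,\pi]$, $\mathrm{Arc}^+_\theta(z)=\{|z|e^{j(\theta+\varphi)}:|\varphi|\le\psi\}$ and $\mathrm{Arc}^-_\theta(z)=\{|z|e^{j(\theta+\varphi)}:\psi\le|\varphi|\le\pi\}$ (the circular arcs centered at $0$ joining $z$ and its mirror image $\overline{z}e^{2j\theta}$ crossing the ray $e^{j\theta}\mathbb{R}^+$, resp. $e^{j\theta}\mathbb{R}^-$). A matrix set $\mathcal{C}$ satisfies the $\theta$-arc property if either $\mathrm{Arc}^+_\theta(z)\subset\mathrm{SRG}_\theta(\mathcal{C})$ for all $z\in\mathrm{SRG}_\theta(\mathcal{C})$, or $\mathrm{Arc}^-_\theta(z)\subset\mathrm{SRG}_\theta(\mathcal{C})$ for all $z\in\mathrm{SRG}_\theta(\mathcal{C})$. Products of subsets of $\mathbb{C}$ are elementwise. $[-\infty,-1]$ denotes the (extended) real half-line of numbers $\le-1$. The value of a transfer matrix at $\omega=\infty$ is its limit at infinity. *)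

(* Defs.v *)
From HB Require Import structures.
From mathcomp Require Export all_boot all_order all_algebra.
From mathcomp Require Export spectral complex.
From mathcomp Require Export all_classical all_reals all_analysis.
Export numFieldNormedType.Exports.
Export Order.TTheory GRing.Theory Num.Theory.

Set Implicit Arguments.
Unset Strict Implicit.
Unset Printing Implicit Defensive.

Local Open Scope classical_set_scope.
Local Open Scope ring_scope.
Local Open Scope complex_scope.
Local Open Scope sesquilinear_scope.

Section TransferFunctions.
Variable R : realType.

Notation ratfun := {fraction {poly R}}.

(* repr f is an arbitrary fraction representing f: dividing out the gcd gives
   numerator and denominator in lowest terms, so that the complex roots of
   tf_den f are exactly the poles of f. *)
Definition tf_num (f : ratfun) : {poly R} :=
  let: (p, q) := fraction.frac (repr f) in p %/ gcdp p q.

Definition tf_den (f : ratfun) : {poly R} :=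
  let: (p, q) := fraction.frac (repr f) in q %/ gcdp p q.

Definition polyC_of_R (p : {poly R}) : {poly R[i]} :=
  map_poly (real_complex R) p.

Definition tf_proper (f : ratfun) : Prop :=
  (size (tf_num f) <= size (tf_den f))%N.

(* All poles lie in the open left half-plane. *)
Definition tf_stable (f : ratfun) : Prop :=
  forall s : R[i], root (polyC_of_R (tf_den f)) s -> complex.Re s < 0.

Definition RHinf (m : nat) (P : 'M[ratfun]_m) : Prop :=
  forall i j, tf_proper (P i j) /\ tf_stable (P i j).

Definition tf_eval (f : ratfun) (s : R[i]) : R[i] :=
  (polyC_of_R (tf_num f)).[s] / (polyC_of_R (tf_den f)).[s].

(* R[i]^o is R[i] with the topology of its modulus. *)
Definition tf_eval_oo (f : ratfun) : R[i] :=
  lim ((tf_eval f (0 +i* w) : R[i]^o) @[w --> +oo%R]).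

(* P(jw) for w in [0, +oo]; frequencies are extended reals and the value at
   -oo is junk. *)
Definition freq_resp (m : nat) (P : 'M[ratfun]_m) (w : \bar R) : 'M[R[i]]_m :=
  match w with
  | r%:E => \matrix_(i, j) tf_eval (P i j) (0 +i* r)
  | +oo%E => \matrix_(i, j) tf_eval_oo (P i j)
  | -oo%E => 0
  end.

(* invmx A = A when A is singular, hence the unitmx conjunct. *)
Definition feedback_stable (m N : nat) (P : 'I_N -> 'M[ratfun]_m) : Prop :=
  let S := 1%:M + \prod_(i < N) P i in S \in unitmx /\ RHinf (invmx S).

End TransferFunctions.

Section ScaledRelativeGraphs.
Variable R : realType.

Definition expj (t : R) : R[i] := cos t +i* sin t.

Definition dotc (m : nat) (x y : 'cV[R[i]]_m) : R[i] := (x ^t* *m y) 0 0.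

Definition enorm (m : nat) (x : 'cV[R[i]]_m) : R :=
  Num.sqrt (complex.Re (dotc x x)).

Definition angle (m : nat) (theta : R) (x y : 'cV[R[i]]_m) : R :=
  if (x == 0) || (y == 0) then 0
  else acos (complex.Re (dotc x (expj (- theta) *: y)) / (enorm x * enorm y)).

Definition SRG1 (m : nat) (theta : R) (C : 'M[R[i]]_m) : set R[i] :=
  [set z | exists x : 'cV[R[i]]_m, x != 0 /\
     let gain := (enorm (C *m x) / enorm x)%:C in
     let a := angle theta x (C *m x) in
     z = gain * expj (theta + a) \/ z = gain * expj (theta - a)].

Definition SRG (m : nat) (theta : R) (CC : set 'M[R[i]]_m) : set R[i] :=
  \bigcup_(C in CC) SRG1 theta C.

(* psi is an angle of z relative to the axis of direction theta; it is unique
   unless z = 0. *)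
Definition rel_angle (theta : R) (z : R[i]) (psi : R) : Prop :=
  0 <= psi <= pi /\
  (z = `|z| * expj (theta + psi) \/ z = `|z| * expj (theta - psi)).

Definition Arcp (theta : R) (z : R[i]) : set R[i] :=
  [set w | exists psi phi : R, rel_angle theta z psi /\
     `|phi| <= psi /\ w = `|z| * expj (theta + phi)].

Definition Arcm (theta : R) (z : R[i]) : set R[i] :=
  [set w | exists psi phi : R, rel_angle theta z psi /\
     psi <= `|phi| <= pi /\ w = `|z| * expj (theta + phi)].

Definition arc_property (m : nat) (theta : R) (CC : set 'M[R[i]]_m) : Prop :=
  (forall z, SRG theta CC z -> Arcp theta z `<=` SRG theta CC) \/
  (forall z, SRG theta CC z -> Arcm theta z `<=` SRG theta CC).

Definition set_prod (N : nat) (S : 'I_N -> set R[i]) : set R[i] :=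
  [set z | exists f : 'I_N -> R[i],
     (forall i, S i (f i)) /\ z = \prod_(i < N) f i].

Definition le_minus1 : set R[i] := [set z | exists2 x : R, x <= -1 & z = x%:C].

End ScaledRelativeGraphs.

Arguments le_minus1 {R}.

(* Main.v *)
(* Geometry at a fixed frequency: if [- 1 / t] were an eigenvalue of
   P_1 ... P_N, with eigenvector x, the vectors x, P_N x, P_{N-1} P_N x, ...,
   rotated by the accumulated angles theta_i, are the vertices of a closed
   spherical polygon whose sides are the relative angles of the P_i. The polygon
   inequalities let one shorten all sides but one (this is what the arc property
   allows) until the angles add up to pi, so [- 1 / t] is a product of points of
   the scaled relative graphs. Hence det (I + t P_1 ... P_N) does not vanish on
   the extended imaginary axis for t in [0, 1].

   Homotopy: with a common denominator d, this determinant is p_t / d ^ m where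
   p_t is a real polynomial of constant degree without imaginary roots. Being
   Hurwitz is then both an open and a closed condition on t, by the bound
   |p (s)| >= K (1 + |s|) ^ deg p on the closed right half-plane,
     and p_0 = d ^ m
   is Hurwitz. So p_1 is Hurwitz, and it is the denominator of the inverse. *)
Require Import Defs.
From mathcomp Require Import ring lra.

Set Implicit Arguments.
Unset Strict Implicit.
Unset Printing Implicit Defensive.

Local Open Scope classical_set_scope.
Local Open Scope ring_scope.
Local Open Scope complex_scope.
Import Normc.
Local Notation "x %:F" := (@FracField.tofrac _ x).

(** * Angles and scaled relative graphs *)

Section Angles.
Variables (R : realType) (m : nat).
Implicit Types (x y z : 'cV[R[i]]_m) (t : R).

(** It makes complex m-space a real Euclidean space, in which the angles below are the ordinary
    ones. *)
Definition rdot x y : R := complex.Re (dotc x y).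

Lemma rdotE x y : rdot x y =
  \sum_i (complex.Re (x i 0) * complex.Re (y i 0) +
          complex.Im (x i 0) * complex.Im (y i 0)).
Proof.
rewrite /rdot /dotc mxE raddf_sum; apply: eq_bigr => i _.
rewrite !mxE.
rewrite (_ : Num.conj (x i 0) = conjc (x i 0)) //.
by case: (x i 0) => a b; case: (y i 0) => c d /=; rewrite mulNr opprK.
Qed.

Lemma rdotC x y : rdot x y = rdot y x.
Proof. by rewrite !rdotE; apply: eq_bigr => i _;
  rewrite ![_ * complex.Re (x _ _)]mulrC ![_ * complex.Im (x _ _)]mulrC. Qed.

Lemma rdotDr x y z : rdot x (y + z) = rdot x y + rdot x z.
Proof. by rewrite /rdot /dotc mulmxDr mxE raddfD. Qed.

Lemma rdotZr a x y : rdot x (a%:C *: y) = a * rdot x y.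
Proof.
rewrite !rdotE mulr_sumr; apply: eq_bigr => i _; rewrite mxE.
by case: (y i 0) => c d /=; rewrite !mul0r subr0 addr0; ring.
Qed.

Lemma rdotDl x y z : rdot (x + y) z = rdot x z + rdot y z.
Proof. by rewrite ![rdot _ z]rdotC rdotDr. Qed.

Lemma rdotZl a x y : rdot (a%:C *: x) y = a * rdot x y.
Proof. by rewrite ![rdot _ y]rdotC rdotZr. Qed.

Lemma rdot_ge0 x : 0 <= rdot x x.
Proof. by rewrite rdotE sumr_ge0 // => i _;
  rewrite addr_ge0 // -expr2 sqr_ge0. Qed.

Lemma rdot_gt0 x : x != 0 -> 0 < rdot x x.
Proof.
move=> x0; rewrite lt_neqAle rdot_ge0 andbT eq_sym; apply: contra x0.
rewrite rdotE psumr_eq0 => [/allP x0|i _]; last first.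
  by rewrite addr_ge0 // -expr2 sqr_ge0.
apply/eqP/matrixP => i j; rewrite (ord1 j) mxE; apply/eqP.
have := x0 i (mem_index_enum _);
  rewrite paddr_eq0 -?expr2 ?sqr_ge0 // !sqrf_eq0.
by case: (x i 0) => a b /= /andP[/eqP -> /eqP ->].
Qed.

(** The squared norm of [rdot y y] x - [rdot x y] y equals [rdot y y] times the gap between the two
    sides. *)
Lemma rdot_CS x y : rdot x y ^+ 2 <= rdot x x * rdot y y.
Proof.
have [->|y0] := eqVneq y 0.
  have h z : rdot z 0 = 0 by rewrite /rdot /dotc mulmx0 mxE.
  by rewrite !h mulr0 expr0n.
have yy := rdot_gt0 y0.
have := rdot_ge0 ((rdot y y)%:C *: x + (- rdot x y)%:C *: y).
rewrite !(rdotDl, rdotDr, rdotZl, rdotZr) (rdotC y x).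
rewrite (_ : _ + _ = rdot y y * (rdot x x * rdot y y - rdot x y ^+ 2));
  last by ring.
by rewrite pmulr_rge0 // subr_ge0.
Qed.

Definition vangle x y : R := acos (rdot x y / (enorm x * enorm y)).

Lemma enorm_gt0 x : x != 0 -> 0 < enorm x.
Proof. by move=> x0; rewrite /enorm sqrtr_gt0; exact: rdot_gt0. Qed.

Lemma enorm_sqr x : enorm x ^+ 2 = rdot x x.
Proof. by rewrite /enorm sqr_sqrtr //; exact: rdot_ge0. Qed.

Lemma vcos_bound x y : x != 0 -> y != 0 ->
  -1 <= rdot x y / (enorm x * enorm y) <= 1.
Proof.
move=> x0 y0; have nx := enorm_gt0 x0; have ny := enorm_gt0 y0.
rewrite -ler_norml -[leRHS](normr1 R) -ler_sqr ?nnegrE ?normr_ge0 //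
  !real_normK ?num_real //.
rewrite expr1n expr_div_n ler_pdivrMr ?exprn_gt0 ?mulr_gt0 // mul1r exprMn
  !enorm_sqr.
exact: rdot_CS.
Qed.

Lemma vangle_ge0 x y : x != 0 -> y != 0 -> 0 <= vangle x y.
Proof. by move=> x0 y0; apply/acos_ge0/vcos_bound. Qed.

Lemma vangle_lepi x y : x != 0 -> y != 0 -> vangle x y <= pi.
Proof. by move=> x0 y0; apply/acos_lepi/vcos_bound. Qed.

Lemma cos_vangle x y : x != 0 -> y != 0 ->
  cos (vangle x y) = rdot x y / (enorm x * enorm y).
Proof. by move=> x0 y0; rewrite acosK // in_itv; exact: vcos_bound. Qed.

Lemma vangleC x y : vangle x y = vangle y x.
Proof. by rewrite /vangle rdotC (mulrC (enorm x)). Qed.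

Lemma vanglexx x : x != 0 -> vangle x x = 0.
Proof.
move=> x0; rewrite /vangle -enorm_sqr expr2 divff ?acos1 //.
by rewrite mulf_neq0 // gt_eqF // enorm_gt0.
Qed.

(* Cauchy-Schwarz for the components of [x] and [z] orthogonal to [y]
   gives [cos (a + b) <= cos c]. *)
Lemma vangle_triangle x y z : x != 0 -> y != 0 -> z != 0 ->
  vangle x z <= vangle x y + vangle y z.
Proof.
move=> x0 y0 z0.
(* Only a sum of at most pi needs work; there [cos] is decreasing and the claim becomes an
   inequality between cosines. *)
have [sum_le|/ltW sum_ge] := leP (vangle x y + vangle y z) pi; last first.
  exact: le_trans (vangle_lepi x0 z0) sum_ge.
rewrite leNgt; apply/negP.
rewrite -ltr_cos ?in_itv /= ?vangle_ge0 ?vangle_lepi ?addr_ge0 ?vangle_ge0 //.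
apply/negP; rewrite -leNgt cosD.
rewrite !(sin_acos (vcos_bound _ _)) // !cos_vangle //.
have nx := enorm_gt0 x0; have ny := enorm_gt0 y0; have nz := enorm_gt0 z0.
have inv v : v != 0 -> rdot ((enorm v)^-1%:C *: v) ((enorm v)^-1%:C *: v) = 1.
  move=> v0; rewrite rdotZl rdotZr -enorm_sqr mulrA -expr2 -exprMn mulVf
    ?expr1n //.
  by rewrite gt_eqF ?enorm_gt0.
set u := (enorm x)^-1%:C *: x; set v := (enorm y)^-1%:C *: y.
set w := (enorm z)^-1%:C *: z.
have E a b : rdot a b / (enorm a * enorm b) =
    rdot ((enorm a)^-1%:C *: a) ((enorm b)^-1%:C *: b).
  by rewrite rdotZl rdotZr invfM; ring.
rewrite !E -/u -/v -/w.
have uu : rdot u u = 1 by exact: inv.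
have vv : rdot v v = 1 by exact: inv.
have ww : rdot w w = 1 by exact: inv.
have uv := vcos_bound x0 y0; have vw := vcos_bound y0 z0.
rewrite E -/u -/v in uv; rewrite E -/v -/w in vw.
clearbody u v w.
have := rdot_CS (u + (- rdot u v)%:C *: v) (w + (- rdot v w)%:C *: v).
rewrite !(rdotDl, rdotDr, rdotZl, rdotZr) (rdotC v u) (rdotC w v) uu vv ww =>
  CS.
rewrite lerBlDr -lerBlDl -sqrtrM; last by nra.
apply: (le_trans (ler_norm _)); rewrite -sqrtr_sqr; apply: ler_wsqrtr.
by apply: le_trans (le_trans _ CS) _; rewrite le_eqVlt; apply/orP; left;
  apply/eqP; ring.
Qed.

Lemma vangle_path (y : nat -> 'cV[R[i]]_m) a n : (forall i, y i != 0) ->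
  vangle (y a) (y (a + n)%N) <= \sum_(a <= i < a + n) vangle (y i) (y i.+1).
Proof.
move=> y0; elim: n => [|n IHn]; first by rewrite addn0 vanglexx // big_geq.
rewrite addnS big_nat_recr /= ?leq_addr //.
by apply: le_trans (vangle_triangle _ (y0 (a + n)%N) _) _ => //; rewrite lerD2r.
Qed.

End Angles.

(** * Unit complex numbers *)

Section Phases.
Variable R : realType.
Implicit Types t a b : R.

Lemma expjD a b : expj (a + b) = expj a * expj b.
Proof.
by rewrite /expj cosD sinD; apply/eqP; rewrite eq_complex /= addrC eqxx /=;
  apply/eqP; ring.
Qed.

Lemma expj0 : expj (0 : R) = 1.
Proof. by rewrite /expj cos0 sin0. Qed.

Lemma expj_pi : expj (pi : R) = -1.
Proof. by rewrite /expj cospi sinpi; apply/eqP;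
  rewrite eq_complex /= oppr0 !eqxx. Qed.

Lemma expj_Npi : expj (- pi : R) = -1.
Proof. by rewrite /expj cosN sinN cospi sinpi; apply/eqP;
  rewrite eq_complex /= oppr0 !eqxx. Qed.

Lemma normc_expj t : `|expj t| = 1.
Proof. by rewrite normc_def /= cos2Dsin2 sqrtr1. Qed.

Lemma expj_neq0 t : expj t != 0.
Proof. by rewrite -normr_eq0 normc_expj oner_eq0. Qed.

Lemma expj_sum (I : Type) (r : seq I) (P : pred I) (F : I -> R) :
  expj (\sum_(i <- r | P i) F i) = \prod_(i <- r | P i) expj (F i).
Proof. by apply: (big_morph _ expjD expj0). Qed.

Lemma norm_gain_expj g t : 0 <= g -> `|g%:C * expj t| = g%:C.
Proof. by move=> g0; rewrite normrM normc_expj mulr1 ger0_norm // ler0c. Qed.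

End Phases.

(** * Rotations, and the arcs inside a scaled relative graph *)

Section ScaledGraph.
Variables (R : realType) (m : nat).
Implicit Types (x y : 'cV[R[i]]_m) (t : R).

Lemma rdot_expj t x y : rdot (expj t *: x) (expj t *: y) = rdot x y.
Proof.
rewrite !rdotE; apply: eq_bigr => i _; rewrite !mxE.
case: (x i 0) => a b; case: (y i 0) => c d /=.
transitivity ((cos t ^+ 2 + sin t ^+ 2) * (a * c + b * d)); first by ring.
by rewrite cos2Dsin2 mul1r.
Qed.

Lemma enorm_expj t x : enorm (expj t *: x) = enorm x.
Proof. by rewrite /enorm -!/(rdot _ _) rdot_expj. Qed.

Lemma vangle_expj t x y : vangle (expj t *: x) (expj t *: y) = vangle x y.
Proof. by rewrite /vangle rdot_expj !enorm_expj. Qed.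

Lemma expj_scale_neq0 t x : x != 0 -> expj t *: x != 0.
Proof. by move=> x0; rewrite scaler_eq0 negb_or expj_neq0. Qed.

Lemma enormN x : enorm (- x) = enorm x.
Proof. by rewrite -scaleN1r -expj_pi enorm_expj. Qed.

Lemma enorm_neg_scale (lam : R) x : lam < 0 ->
  enorm (lam%:C *: x) = - lam * enorm x.
Proof.
move=> lam0; rewrite /enorm -!/(rdot _ _) rdotZl rdotZr mulrA -expr2.
by rewrite sqrtrM ?sqr_ge0 // sqrtr_sqr ltr0_norm.
Qed.

(** The rotated vector is cos t x + sin t jx, and jx is orthogonal to x for the real inner
    product. *)
Lemma rdot_expj_self t x : rdot x (expj t *: x) = cos t * rdot x x.
Proof.
rewrite !rdotE mulr_sumr; apply: eq_bigr => i _; rewrite mxE.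
by case: (x i 0) => a b /=; ring.
Qed.

Lemma vangleNr x y : x != 0 -> y != 0 -> vangle x (- y) = pi - vangle x y.
Proof.
move=> x0 y0; rewrite /vangle enormN -acosN ?vcos_bound //.
by congr acos; rewrite -[- y]scaleN1r -(rmorphN1 (real_complex R)) rdotZr
  mulN1r mulNr.
Qed.

Lemma angleE t x y : x != 0 -> y != 0 ->
  angle t x y = vangle x (expj (- t) *: y).
Proof. by move=> x0 y0;
  rewrite /angle (negPf x0) (negPf y0) /vangle enorm_expj. Qed.

Section OneMatrix.
Variables (theta : R) (CC : set 'M[R[i]]_m) (C : 'M[R[i]]_m) (x : 'cV[R[i]]_m).
Hypotheses (CCC : CC C) (x0 : x != 0) (Cx0 : C *m x != 0).
Let gain := enorm (C *m x) / enorm x.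
Let psi t := vangle x (expj (- t) *: (C *m x)).

Let gain_ge0 : 0 <= gain.
Proof. by rewrite divr_ge0 // ltW // enorm_gt0. Qed.

Lemma SRG_endpoint phi : `|phi| = psi theta ->
  SRG theta CC (gain%:C * expj (theta + phi)).
Proof.
move=> E; exists C => //; exists x; split => //=; rewrite angleE //.
rewrite -/(psi theta) -E -/gain; case: (ger0P phi) => h; first by left.
by right; rewrite opprK.
Qed.

Let psi_ge0 t : 0 <= psi t.
Proof. by rewrite vangle_ge0 ?expj_scale_neq0. Qed.

Let psi_lepi t : psi t <= pi.
Proof. by rewrite vangle_lepi ?expj_scale_neq0. Qed.

(* For the minus arcs, measuring from the opposite ray turns [psi] into
   [pi - psi], and the arc becomes a plus arc. *)
Lemma SRG_arc : arc_property theta CC ->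
  exists t, forall phi, `|phi| <= psi t ->
    SRG theta CC (gain%:C * expj (t + phi)).
Proof.
have end1 : SRG theta CC (gain%:C * expj (theta + psi theta)).
  by apply: SRG_endpoint; rewrite ger0_norm ?psi_ge0.
have relE : rel_angle theta (gain%:C * expj (theta + psi theta)) (psi theta).
  by split; [rewrite psi_ge0 psi_lepi|left; rewrite norm_gain_expj].
case=> arc.
  exists theta => phi phile; apply: (arc _ end1).
  by exists (psi theta), phi; split => //; split => //; rewrite norm_gain_expj.
exists (theta + pi) => phi.
have -> : psi (theta + pi) = pi - psi theta.
  rewrite /psi opprD expjD expj_Npi mulrN1 scaleNr vangleNr //.
  exact: expj_scale_neq0.
move=> phile; apply: (arc _ end1).
have pi0 : 0 <= pi :> R by exact: pi_ge0.
have p0 := psi_ge0 theta; have ppi := psi_lepi theta.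
(* An angle from the opposite ray is turned back into one from [theta]; the sign of the shift by pi
   keeps it in [-pi, pi]. *)
exists (psi theta), (if 0 <= phi then phi - pi else phi + pi); split => //.
case: ifPn => h; rewrite norm_gain_expj //; rewrite -?ltNge in h.
  rewrite ger0_norm // in phile.
  split; last by congr (_ * _);
    rewrite !(expjD _ phi) (expjD theta) (expjD theta) (expjD phi (- pi))
      expj_pi expj_Npi; ring.
  by rewrite ler0_norm; lra.
rewrite ltr0_norm // in phile.
split; last by congr (_ * _); rewrite -addrA [pi + phi]addrC.
by rewrite ger0_norm; lra.
Qed.

End OneMatrix.
End ScaledGraph.

(** At least n among n + 1 indices leave out at most one; [k] is that one, or arbitrary if there is
    none. *)
Lemma setD1_of_card (n : nat) (J : {set 'I_n.+1}) : (n <= #|J|)%N ->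
  exists k : 'I_n.+1, forall i, i != k -> i \in J.
Proof.
move=> Jn; have [/forallP JT|] := boolP [forall i, i \in J];
  first by exists ord0.
rewrite negb_forall => /existsP[k kJ]; exists k => i ik.
have /eqP -> : J == [set~ k]%SET.
  rewrite eqEcard cardsC1 card_ord Jn andbT.
  by apply/fintype.subsetP => j jJ; rewrite !inE; apply: contraNneq kJ => <-.
by rewrite !inE.
Qed.

(* Closing up a spherical polygon whose sides are [alpha] and the [psi i]:
   all sides but the [k]-th may be shortened so that the angles add up. *)
Lemma angle_budget (R : realType) (I : finType) (psi : I -> R)
  (k : I) (alpha : R) :
  (forall i, 0 <= psi i) ->
  alpha <= \sum_i psi i -> psi k <= alpha + \sum_(i | i != k) psi i ->
  exists phi : I -> R, [/\ forall i, `|phi i| <= psi i, phi k = psi k &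
    \sum_i phi i = alpha].
Proof.
move=> psi0; rewrite (bigD1 k) //=; set B := \sum_(i | i != k) psi i => h1 h2.
have B0 : 0 <= B by rewrite sumr_ge0.
(* The common ratio applied to all sides but the k-th; it may be negative. If [B] = 0 the division
   yields 0, and the hypotheses force [alpha] = [psi k]. *)
pose r := (alpha - psi k) / B.
have r1 : `|r| <= 1.
  have [B_0|Bn0] := eqVneq B 0; first by rewrite /r B_0 invr0 mulr0 normr0.
  have Bp : 0 < B by rewrite lt_neqAle eq_sym Bn0.
  rewrite /r normrM normfV (ger0_norm B0) ler_pdivrMr // mul1r ler_norml.
  by apply/andP; split; lra.
have rB : r * B = alpha - psi k.
  have [B_0|Bn0] := eqVneq B 0; last by rewrite /r divfK.
  by rewrite B_0 mulr0; move: h1 h2; rewrite B_0; lra.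
exists (fun i => if i == k then psi k else r * psi i); split.
- move=> i; case: eqP => [->|_]; first by rewrite ger0_norm.
  by rewrite normrM (ger0_norm (psi0 i)) ler_piMl.
- by rewrite eqxx.
rewrite (bigD1 k) //= eqxx (eq_bigr (fun i => r * psi i)) => [|i /negPf -> //].
by rewrite -mulr_sumr -/B rB addrC subrK.
Qed.

Lemma cos_eq_sin (R : realType) (a b : R) : cos a = cos b ->
  sin a = sin b \/ sin a = - sin b.
Proof.
move=> E; have := cos2Dsin2 a; rewrite E -[RHS](cos2Dsin2 b) => /addrI /eqP.
by rewrite eqf_sqr => /orP[/eqP->|/eqP->]; [left|right].
Qed.

Lemma prod_telescope (F : fieldType) (f : nat -> F) n : (forall i, f i != 0) ->
  \prod_(0 <= i < n) (f i / f i.+1) = f 0%N / f n.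
Proof.
move=> f0; elim: n => [|n IHn]; first by rewrite big_geq // divff.
by rewrite big_nat_recr //= IHn mulrA divfK.
Qed.

(** * Negative eigenvalues of the cascade as products of graph points *)

Section Cascade.
Variables (R : realType) (m n : nat).
Variables (theta : 'I_n.+1 -> R) (CC : 'I_n.+1 -> set 'M[R[i]]_m).
Variables (C : 'I_n.+1 -> 'M[R[i]]_m) (J : {set 'I_n.+1}).
Hypotheses (CCC : forall i, CC i (C i)) (Jn : (n <= #|J|)%N).
Hypothesis arcJ : forall i, i \in J -> arc_property (theta i) (CC i).

(** The gains along the orbit of [x] telescope to - [lam], so only the phases remain to be matched:
    they must add up to pi modulo 2 pi. *)
Lemma eigenvalue_mem_set_prod (lam : R) (x : 'cV[R[i]]_m) : lam < 0 -> x != 0 ->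
  (\prod_(i < n.+1) C i) *m x = lam%:C *: x ->
  set_prod (fun i => SRG (theta i) (CC i)) lam%:C.
Proof.
move=> lam0 x0 eigx.
(* [v k] is the signal after the factors of index at least k have acted: [v n.+1] is the input [x],
   [v 0] the output. *)
pose v k := (\prod_(k <= i < n.+1) C (inord i)) *m x.
have v0E : v 0 = lam%:C *: x.
  by rewrite /v big_mkord -eigx; congr (_ *m _); apply: eq_bigr => i _;
    rewrite inord_val.
have vlast : v n.+1 = x by rewrite /v big_geq // mul1mx.
have vE k : (k <= n)%N -> v k = C (inord k) *m v k.+1.
  by move=> kn; rewrite /v big_ltn // mulmxA.
have vnz k : v k != 0.
  have [kn|kn] := ltnP n k; first by rewrite /v big_geq // mul1mx.
  elim: k kn => [|k IHk] kn.
    by rewrite v0E scaler_eq0 negb_or x0 andbT eq_complex /= negb_and lt_eqF.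
  by apply: contra (IHk (ltnW kn)); rewrite (vE k (ltnW kn)) => /eqP ->;
    rewrite mulmx0.
have vEo (i : 'I_n.+1) : v i = C i *m v i.+1.
  by rewrite vE -1?ltnS // inord_val.
have [k kJ] := setD1_of_card Jn.
pose ps (i : 'I_n.+1) t := vangle (v i.+1) (expj (- t) *: v i).
pose gain (i : 'I_n.+1) := enorm (v i) / enorm (v i.+1).
(* [t i] is the axis from which factor i realizes angles: all those up to [ps i (t i)] if i differs
   from k, but only the two extreme ones for k, which may lack the arc property. *)
have /choice[t tP] (i : 'I_n.+1) : exists t, forall phi,
    `|phi| <= ps i t -> (i = k -> `|phi| = ps i t) ->
    SRG (theta i) (CC i) ((gain i)%:C * expj (t + phi)).
  have Cv0 : C i *m v i.+1 != 0 by rewrite -vEo.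
  have [->|ik] := eqVneq i k.
    exists (theta k) => phi _ /(_ erefl) E; rewrite /gain vEo.
    by apply: SRG_endpoint => //; rewrite -?vEo.
  have [t tP] := SRG_arc (CCC i) (vnz i.+1) Cv0 (arcJ (kJ _ ik)).
  by exists t => phi h _; rewrite /gain vEo; apply: tP; rewrite -vEo.
(* Undoing the accumulated axes makes the angle between the vertices [y i] and [y i.+1] equal to
   [ps i (t i)]. *)
pose T j := \sum_(j <= i < n.+1) t (inord i).
pose y j := expj (- T j) *: v j.
have ynz j : y j != 0 by exact: expj_scale_neq0.
have yang (i : 'I_n.+1) : vangle (y i) (y i.+1) = ps i (t i).
  rewrite vangleC /y /T (big_ltn (ltn_ord i)) inord_val opprD addrC expjD
    -scalerA vangle_expj.
  by [].
pose psi j := vangle (y j) (y j.+1).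
pose alpha := vangle (y 0) (y n.+1).
have psi0 j : 0 <= psi j by rewrite vangle_ge0.
have alpha_le : alpha <= \sum_(i < n.+1) psi i.
  by have := vangle_path 0 n.+1 ynz; rewrite add0n big_mkord.
(* Side k is bounded by the way round the polygon: from [y k] back to [y 0], across to [y n.+1], and
   back to [y k.+1]. *)
have psik_le : psi k <= alpha + \sum_(i < n.+1 | i != k) psi i.
  have sumE : \sum_(i < n.+1 | i != k) psi i =
      \sum_(0 <= i < k) psi i + \sum_(k.+1 <= i < n.+1) psi i.
    have D : \sum_(i < n.+1) psi i = psi k + \sum_(i < n.+1 | i != k) psi i.
      by rewrite (bigD1 k).
    apply: (addrI (psi k)); rewrite -D.
    rewrite -(big_mkord xpredT psi) (@big_cat_nat _ _ _ k) //= 1?ltnW //.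
    by rewrite (big_ltn (ltn_ord k)) addrCA.
  have h1 := vangle_path 0 k ynz; have h2 := vangle_path k.+1 (n.+1 - k.+1) ynz.
  rewrite add0n in h1; rewrite subnKC // in h2.
  have h3 := vangle_triangle (ynz k) (ynz 0%N) (ynz k.+1).
  have h4 := vangle_triangle (ynz 0%N) (ynz n.+1) (ynz k.+1).
  rewrite (vangleC (y 0%N)) in h1; rewrite (vangleC (y k.+1)) in h2.
  rewrite sumE addrCA; apply: (le_trans h3); apply: lerD h1 _.
  by apply: (le_trans h4); rewrite lerD2l.
have [phi [phi_le phik phi_sum]] := angle_budget (fun i :
  'I_n.+1 => psi0 i) alpha_le psik_le.
have T0 : T 0%N = \sum_i t i.
  by rewrite /T big_mkord; apply: eq_bigr => i _; rewrite inord_val.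
(* [y 0] is [x] scaled by the negative [lam] and rotated by - [T 0], while [y n.+1] is [x]
   itself. *)
have cosa : cos alpha = cos (pi - T 0).
  rewrite cos_vangle // /y /T (big_geq (leqnn _)) oppr0 expj0 scale1r vlast v0E.
  rewrite -/(T 0%N) enorm_expj rdotC.
  rewrite cosB cospi sinpi mul0r addr0 mulN1r.
  rewrite enorm_neg_scale //.
  rewrite scalerA (mulrC (expj _)) -scalerA rdotZr rdot_expj_self cosN
    -enorm_sqr.
  by field; rewrite gt_eqF ?enorm_gt0 // lt_eqF.
(* The cosine fixes [alpha] only up to sign modulo 2 pi; [s] records the orientation of the polygon.
   Multiplying every [phi i] by [s] preserves the bounds on absolute values. *)
have [s [s1 /= sE]] : exists s : R, `|s| = 1 /\ expj (T 0%N + s * alpha) = -1.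
  have sp : expj (T 0%N + (pi - T 0%N)) = -1 by rewrite addrC subrK expj_pi.
  have [E|E] := cos_eq_sin cosa.
    exists 1; rewrite normr1; split => //;
      rewrite -[RHS]sp mul1r !(expjD (T 0%N)).
    by rewrite /expj cosa E.
  exists (-1); rewrite normrN1; split => //;
    rewrite -[RHS]sp mulN1r !(expjD (T 0%N)).
  by rewrite /expj cosN sinN cosa E opprK.
exists (fun i => (gain i)%:C * expj (t i + s * phi i)); split => [i|].
  apply: tP; first by rewrite normrM s1 mul1r -yang.
  move=> ik; rewrite ik normrM s1 mul1r phik (ger0_norm (psi0 k)).
  exact: yang.
rewrite big_split /= -expj_sum big_split /= -mulr_sumr phi_sum -T0 sE.
rewrite -rmorph_prod /= -(big_mkord xpredT (fun i =>
  enorm (v i) / enorm (v i.+1))).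
have -> : \prod_(0 <= i < n.+1) (enorm (v i) / enorm (v i.+1)) = enorm (v 0) /
  enorm (v n.+1).
  by apply: prod_telescope => i; rewrite gt_eqF // enorm_gt0.
rewrite vlast v0E enorm_neg_scale // mulfK ?gt_eqF ?enorm_gt0 //.
by rewrite mulrN1 -rmorphN /= opprK.
Qed.

Hypothesis disj : le_minus1 `&` set_prod (fun i => SRG (theta i) (CC i)) = set0.

(** For t > 0 a kernel vector is an eigenvector of the product for - 1 / t, which is at most -1; for
    t = 0 the matrix is the identity. *)
Lemma det_return_difference_neq0 (t : R) : 0 <= t <= 1 ->
  \det (1%:M + t%:C *: \prod_(i < n.+1) C i) != 0.
Proof.
(* [det0P] provides a row vector, hence the passage to the transpose. *)
move=> /andP[t0 t1]; rewrite -det_tr; apply/negP => /det0P[w w0].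
rewrite -[w]trmxK -trmx_mul => /(congr1 trmx); rewrite trmxK trmx0.
rewrite mulmxDl mul1mx -scalemxAl; set x := w^T => eqx.
have x0 : x != 0 by rewrite -(inj_eq (@trmx_inj _ _ _)) trmxK trmx0.
have tn0 : t != 0.
  by apply: contra x0 => /eqP tz; move: eqx; rewrite tz scale0r addr0 => ->.
have tp : 0 < t by rewrite lt_neqAle eq_sym tn0.
have eigx : (\prod_(i < n.+1) C i) *m x = (- t^-1)%:C *: x.
  move/eqP: eqx; rewrite addrC addr_eq0 => /eqP /(congr1 ( *:%R (t^-1)%:C)).
  rewrite scalerA -rmorphM /= mulVf // rmorph1 scale1r => ->.
  by rewrite scalerN rmorphN scaleNr.
have lam1 : - t^-1 <= -1 by rewrite lerN2 invf_ge1.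
have lam0 : - t^-1 < 0 by rewrite oppr_lt0 invr_gt0.
have : (le_minus1 `&` set_prod (fun i => SRG (theta i) (CC i))) (- t^-1)%:C.
  by split; [exists (- t^-1)|exact: eigenvalue_mem_set_prod lam0 x0 eigx].
by rewrite disj.
Qed.

End Cascade.

(** * Hurwitz polynomials and their homotopies *)

Section Modulus.
Variable R : realType.
Implicit Types (s z : R[i]).

Lemma normr_normc z : `|z| = (normc z)%:C.
Proof. by case: z. Qed.

Lemma normc_ge0 z : 0 <= normc z.
Proof. by case: z => a b /=; exact: sqrtr_ge0. Qed.

Lemma normc_real (a : R) : normc a%:C = `|a|.
Proof. by rewrite /= expr0n addr0 sqrtr_sqr. Qed.

Lemma normcX z n : normc (z ^+ n) = normc z ^+ n.
Proof. by elim: n => [|n IHn]; rewrite ?expr0 ?normc1 // !exprS normcM IHn. Qed.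

Lemma normc_ge_absRe z : `|complex.Re z| <= normc z.
Proof. by rewrite -lecR -normr_normc normc_ge_Re. Qed.

Lemma le_normc_sum (I : Type) (r : seq I) (F : I -> R[i]) :
  normc (\sum_(i <- r) F i) <= \sum_(i <- r) normc (F i).
Proof.
elim: r => [|i r IHr]; first by rewrite !big_nil normc0.
by rewrite !big_cons (le_trans (le_normcD _ _)) // lerD2l.
Qed.

Lemma le_normcB s z : normc s <= normc (s - z) + normc z.
Proof. by rewrite -{1}[s](subrK z) le_normcD. Qed.

End Modulus.

Section Hurwitz.
Variable R : realType.
Implicit Types (p q : {poly R}) (s z : R[i]).

(** The condition that [tf_stable] puts on the denominator. It excludes the zero polynomial, of
    which every point is a root. *)
Definition hurwitz p := forall s, root (polyC_of_R p) s -> complex.Re s < 0.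

Lemma hurwitz_neq0 p : hurwitz p -> p != 0.
Proof.
move=> hp; apply/eqP => p0; have := hp 0.
by rewrite p0 /polyC_of_R rmorph0 root0 ltxx => /(_ isT).
Qed.

Lemma size_polyC_of_R p : size (polyC_of_R p) = size p.
Proof. exact: size_map_poly. Qed.

Lemma coef_polyC_of_R p i : (polyC_of_R p)`_i = (p`_i)%:C.
Proof. exact: coef_map. Qed.

Lemma hurwitz_mul p q : hurwitz p -> hurwitz q -> hurwitz (p * q).
Proof.
by move=> hp hq s; rewrite /polyC_of_R rmorphM rootM => /orP[/hp|/hq].
Qed.

Lemma hurwitz_dvd p q : p %| q -> hurwitz q -> hurwitz p.
Proof.
move=> /dvdpP[c ->] h s ps; apply: h.
by rewrite /polyC_of_R rmorphM rootM; apply/orP; right.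
Qed.

Lemma hurwitz1 : hurwitz 1.
Proof. by move=> s; rewrite /polyC_of_R rmorph1 (negPf (root1 _)). Qed.

(** With a = - Re z, both a <= |s - z| and |s| <= |s - z| + |z| hold, whence 1 + |s| <= c |s - z|
    for c = 1 + (1 + |z|) / a. *)
Lemma normc_sub_lower z : complex.Re z < 0 -> exists2 d : R, 0 < d &
  forall s, 0 <= complex.Re s -> d * (1 + normc s) <= normc (s - z).
Proof.
move=> z0; set a := - complex.Re z.
have a0 : 0 < a by rewrite oppr_gt0.
pose c := 1 + (1 + normc z) / a.
have c0 : 0 < c by rewrite addr_gt0 // divr_gt0 // ltr_wpDr // normc_ge0.
exists c^-1; first by rewrite invr_gt0.
move=> s s0; rewrite mulrC ler_pdivrMr // /c mulrDr mulr1.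
have h1 : a <= normc (s - z).
  apply: le_trans (normc_ge_absRe _); apply: le_trans (ler_norm _).
  by rewrite raddfB /= /a; lra.
have h2 := le_normcB s z.
have h3 : 1 + normc z <= normc (s - z) * ((1 + normc z) / a).
  rewrite mulrCA ler_peMr ?addr_ge0 ?normc_ge0 //.
  by rewrite ler_pdivlMr // mul1r.
lra.
Qed.

Lemma prod_root_lower (r : seq R[i]) : (forall z, z \in r ->
  complex.Re z < 0) ->
  exists2 K : R, 0 < K & forall s, 0 <= complex.Re s ->
    K * (1 + normc s) ^+ size r <= normc (\prod_(z <- r) (s - z)).
Proof.
elim: r => [_|z r IHr hr].
  by exists 1 => // s _; rewrite big_nil normc1 expr0 mulr1.
have [K K0 hK] : exists2 K : R, 0 < K & forall s, 0 <= complex.Re s ->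
    K * (1 + normc s) ^+ size r <= normc (\prod_(z <- r) (s - z)).
  by apply: IHr => y yr; apply: hr; rewrite inE yr orbT.
have [d d0 hd] := normc_sub_lower (hr z (mem_head _ _)).
exists (d * K) => [|s s0]; first exact: mulr_gt0.
rewrite big_cons normcM /= exprS mulrACA.
have h : 0 <= 1 + normc s by rewrite addr_ge0 ?normc_ge0.
by apply: ler_pM; rewrite ?hd ?hK // mulr_ge0 ?exprn_ge0 // ltW.
Qed.

Lemma hurwitz_factor p : hurwitz p -> exists r : seq R[i],
  [/\ size r = (size p).-1, forall z, z \in r -> complex.Re z < 0 &
   forall s, normc (polyC_of_R p).[s] = `|lead_coef p| * normc (\prod_(z <- r)
     (s - z))].
Proof.
move=> hp; have pn0 := hurwitz_neq0 hp.
have [r rE] := closed_field_poly_normal (polyC_of_R p).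
have lcE : lead_coef (polyC_of_R p) = (lead_coef p)%:C by exact: lead_coef_map.
have lc0 : lead_coef (polyC_of_R p) != 0.
  by rewrite lcE -(rmorph0 (real_complex R)) (inj_eq (@complexI _))
    lead_coef_eq0.
exists r; split.
- by rewrite -size_polyC_of_R rE size_scale // size_prod_XsubC.
- by move=> z zr; apply: hp; rewrite rE rootZ // root_prod_XsubC.
move=> s; rewrite rE hornerZ normcM horner_prod lcE normc_real;
  congr (_ * normc _).
by apply: eq_bigr => z _; rewrite hornerXsubC.
Qed.

(** Each root contributes a factor 1 + |s|. The exponent is the full degree, so small changes of the
    coefficients up to that degree are absorbed uniformly in s. *)
Lemma hurwitz_lower p : hurwitz p -> exists2 K : R, 0 < K &
  forall s, 0 <= complex.Re s ->
    K * (1 + normc s) ^+ (size p).-1 <= normc (polyC_of_R p).[s].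
Proof.
move=> hp; have [r [sr hr pE]] := hurwitz_factor hp.
have [K K0 hK] := prod_root_lower hr.
exists (`|lead_coef p| * K) => [|s s0].
  by rewrite mulr_gt0 // normr_gt0 lead_coef_eq0 hurwitz_neq0.
by rewrite pE -sr -mulrA ler_wpM2l // hK.
Qed.

(** Each root contributes |s - z| >= Re s. Unlike in [hurwitz_lower], the constant involves only the
    leading coefficient, so it is controlled along a homotopy. *)
Lemma hurwitz_lower_Re p s : hurwitz p -> 0 <= complex.Re s ->
  `|lead_coef p| * complex.Re s ^+ (size p).-1 <= normc (polyC_of_R p).[s].
Proof.
move=> hp s0; have [r [<- hr ->]] := hurwitz_factor hp.
rewrite ler_wpM2l //; elim: r hr => [|z r IHr] hr.
  by rewrite big_nil normc1 expr0.
rewrite big_cons normcM /= exprS; apply: ler_pM; rewrite ?exprn_ge0 //.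
  apply: le_trans (normc_ge_absRe _); apply: le_trans (ler_norm _).
  by have := hr z (mem_head _ _); rewrite raddfB /=; lra.
by apply: IHr => y yr; apply: hr; rewrite inE yr orbT.
Qed.

Lemma horner_upper p n s : (size p <= n.+1)%N ->
  normc (polyC_of_R p).[s] <= (\sum_(i < n.+1) `|p`_i|) * (1 + normc s) ^+ n.
Proof.
move=> pn; rewrite (@horner_coef_wide _ n.+1) ?size_polyC_of_R //.
rewrite mulr_suml; apply: (le_trans (le_normc_sum _ _)).
apply: ler_sum => i _; rewrite coef_polyC_of_R normcM normc_real normcX.
rewrite ler_wpM2l //; have s0 := normc_ge0 s.
apply: (@le_trans _ _ ((1 + normc s) ^+ i)).
  by rewrite lerXn2r ?nnegrE ?addr_ge0 // ler_wpDl.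
by apply: ler_weXn2l; rewrite ?lerDl -1?ltnS.
Qed.

Lemma root_polyC_of_R_conj (p : {poly R}) s : root (polyC_of_R p) s ->
  root (polyC_of_R p) (conjc s).
Proof.
move=> ps; have :
  root (map_poly conjc (polyC_of_R p)) (conjc s) by rewrite rmorph_root.
congr root; apply/polyP => i; rewrite coef_map coef_polyC_of_R;
  exact: conjc_real.
Qed.

(** * Polynomial families of constant degree without imaginary roots *)

Section Homotopy.
Variable Q : {poly {poly R}}.
(** The outer indeterminate of [Q] is the homotopy parameter; its coefficients are polynomials in
    the Laplace variable. *)
Let p (t : R) : {poly R} := Q.[t%:P].

Lemma coef_family_continuous i : continuous (fun t => (p t)`_i).
Proof.
pose c : {poly R} := \poly_(k < size Q) (Q`_k)`_i.
have -> : (fun t => (p t)`_i) = horner c.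
  apply/funext => t; rewrite /p horner_coef coef_sum horner_poly.
  by apply: eq_bigr => k _; rewrite -polyC_exp coefMC.
exact: continuous_horner.
Qed.

Lemma coef_family_near n t0 (e : R) : 0 < e -> exists2 d : R, 0 < d &
  forall t, `|t - t0| < d -> \sum_(i < n) `|(p t - p t0)`_i| < e.
Proof.
move=> e0; pose g t := \sum_(i < n) `|(p t - p t0)`_i|.
have gc : continuous g.
  apply: (@continuous_big _ _ +%R 0 xpredT);
    [exact: add_continuous | move=> i _ t].
  apply: cvg_norm; rewrite (_ : (fun u => _) = (fun u =>
    (p u)`_i - (p t0)`_i)); last first.
    by apply/funext => u; rewrite coefB.
  rewrite coefB; apply: cvgB; [exact: coef_family_continuous|exact: cvg_cst].
have g0 : g t0 = 0 by rewrite /g big1 // => i _; rewrite subrr coef0 normr0.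
have /cvgrPdist_lt/(_ _ e0) := gc t0.
move=> /nbhs_ballP[d /= d0 hd]; exists d => // t td.
have := hd t; rewrite /ball /= distrC g0 sub0r normrN => /(_ td).
exact: le_lt_trans (ler_norm _).
Qed.

Variable n : nat.
Hypothesis size_p : forall t, 0 <= t <= 1 -> size (p t) = n.+1.
Hypothesis axis : forall t s, 0 <= t <= 1 -> complex.Re s = 0 ->
  ~~ root (polyC_of_R (p t)) s.

(** If [p t0] is Hurwitz, [hurwitz_lower] beats the perturbation, so no root enters the closed right
    half-plane. If not, [p t0] has a root [s0] with Re s0 > 0, where [p t] is small; a Hurwitz [p t]
    would violate [hurwitz_lower_Re] there. *)
Lemma hurwitz_locally_constant t0 : 0 <= t0 <= 1 -> exists2 d : R, 0 < d &
  forall t, 0 <= t <= 1 -> `|t - t0| < d -> (hurwitz (p t) <-> hurwitz (p t0)).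
Proof.
move=> t01; have sz0 := size_p t01.
have dist t s : 0 <= t <= 1 ->
  normc ((polyC_of_R (p t)).[s] - (polyC_of_R (p t0)).[s]) <=
    (\sum_(i < n.+1) `|(p t - p t0)`_i|) * (1 + normc s) ^+ n.
  move=> tI; rewrite -hornerN -hornerD -rmorphB /=; apply: horner_upper.
  by apply: leq_trans (size_polyD _ _) _; rewrite size_polyN !size_p // maxnn.
have pos s : 0 < (1 +
  normc s) ^+ n by rewrite exprn_gt0 // ltr_wpDr // normc_ge0.
have [h0|nh0] := pselect (hurwitz (p t0)).
  have [K K0 hK] := hurwitz_lower h0; rewrite sz0 /= in hK.
  have [d d0 hd] := coef_family_near n.+1 t0 K0; exists d => // t tI td.
  split=> // _ s ps; rewrite ltNge; apply/negP => s0.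
  have := dist t s tI; rewrite (rootP ps) sub0r normcN leNgt => /negP; apply.
  by apply: lt_le_trans (hK s s0); rewrite ltr_pM2r // hd.
have [s0 ps0 s0_ge] : exists2 s, root (polyC_of_R (p t0)) s & 0 <= complex.Re s.
  apply: contrapT => no; apply: nh0 => s ps; rewrite ltNge; apply/negP => s0.
  by apply: no; exists s.
have s0_gt : 0 < complex.Re s0.
  rewrite lt_neqAle s0_ge andbT eq_sym; apply/eqP => E.
  by have := axis t01 E; rewrite ps0.
set r := complex.Re s0 ^+ n; have r0 : 0 < r by rewrite exprn_gt0.
have lc0 : 0 < `|lead_coef (p t0)| by rewrite normr_gt0 lead_coef_eq0
  -size_poly_gt0 sz0.
set M := (1 + normc s0) ^+ n; have M0 : 0 < M by exact: pos.
(* With G the distance of the coefficients and lc the leading coefficient of [p t0], the bounds at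
   [s0] give (|lc| - G) r <= G M; this fails exactly when G < [e]. *)
pose e := `|lead_coef (p t0)| * r / (M + r).
have e0 : 0 < e by rewrite divr_gt0 ?mulr_gt0 ?addr_gt0.
have [d d0 hd] := coef_family_near n.+1 t0 e0; exists d => // t tI td.
split=> // ht; exfalso.
have h1 := hurwitz_lower_Re ht s0_ge; rewrite size_p //= -/r in h1.
have h2 := dist t s0 tI; rewrite (rootP ps0) subr0 -/M in h2.
have h3 := hd t td; set G := \sum_(i < n.+1) _ in h2 h3.
(* As the degree is constant, the difference of the leading coefficients is one of the terms of
   [G]. *)
have h4 : `|lead_coef (p t0)| - G <= `|lead_coef (p t)|.
  rewrite lerBlDr addrC -lerBlDr.
  have := lerB_dist (lead_coef (p t0)) (lead_coef (p t)).
  move=> /le_trans; apply; rewrite /G big_ord_recr /= distrC.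
  rewrite !lead_coefE !size_p //= -coefB lerDr.
  by apply: sumr_ge0.
have h5 : (`|lead_coef (p t0)| - G) * r <= G * M.
  by apply: le_trans (le_trans h1 h2); rewrite ler_wpM2r // ltW.
have : G * (M + r) < `|lead_coef (p t0)| * r by rewrite -ltr_pdivlMr ?addr_gt0.
by move: h5; rewrite mulrBl lerBlDr -mulrDr => /le_lt_trans h /h; rewrite ltxx.
Qed.

End Homotopy.

(** The points of [0, 1] where [A] holds form a nonempty, relatively open and closed subset of a
    connected set. *)
Lemma unit_segment_induction (A : R -> Prop) :
  (forall t0, 0 <= t0 <= 1 -> exists2 d : R, 0 < d &
    forall t, 0 <= t <= 1 -> `|t - t0| < d -> (A t <-> A t0)) ->
  A 0 -> A 1.
Proof.
move=> loc A0.
(* Outside the segment the radius 1 is a dummy value that keeps every ball open. *)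
have /choice[d dP] (t0 : R) : exists d : R, 0 < d /\ (0 <= t0 <= 1 ->
    forall t, 0 <= t <= 1 -> `|t - t0| < d -> (A t <-> A t0)).
  have [h|h] := boolP (0 <= t0 <= 1); last by exists 1.
  by have [d d0 hd] := loc t0 h; exists d.
(* On the segment, [A] is cut out both by the open set [U A] and by the closed complement of [U] of
   the negation of [A]. *)
pose U (B : R -> Prop) :=
  \bigcup_(t in [set t | 0 <= t <= 1 /\ B t]) ball t (d t).
have openU B : open (U B).
  by apply: bigcup_open => t _; apply: ball_open; have [] := dP t.
pose B := [set t | 0 <= t <= 1 /\ A t].
have BE : B = `[(0 : R), 1]%classic.
  apply: (@segment_connected R 0 1).
  - by exists 0; split => //; rewrite lexx ler01.
  - exists (U A) => //; apply/seteqP; split => t.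
      move=> [tI At]; split; first by rewrite /= in_itv.
      by exists t => //; apply: ballxx; have [] := dP t.
    rewrite /= in_itv /= => -[tI [u [uI Au]]]; rewrite /ball /= distrC => tu.
    by split => //; have [_ /(_ uI t tI tu)[_]] := dP u; apply.
  exists (~` U (fun t => ~ A t)); first by rewrite closedC.
  apply/seteqP; split => t.
    move=> [tI At]; split; first by rewrite /= in_itv.
    move=> [u [uI nAu]]; rewrite /ball /= distrC => tu.
    by have [_ /(_ uI t tI tu)[h _]] := dP u; apply/nAu/h.
  rewrite /= in_itv /= => -[tI nU]; split => //; apply: contrapT => nA;
    apply: nU.
  by exists t => //; apply: ballxx; have [] := dP t.
have : B 1 by rewrite BE /= in_itv /= lexx ler01.
by case.
Qed.

Lemma hurwitz_homotopy (Q : {poly {poly R}}) n :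
  (forall t, 0 <= t <= 1 -> size Q.[t%:P] = n.+1) ->
  (forall t s, 0 <= t <= 1 -> complex.Re s = 0 ->
    ~~ root (polyC_of_R Q.[t%:P]) s) ->
  hurwitz Q.[0%:P] -> hurwitz Q.[1%:P].
Proof.
move=> szQ axQ; apply: (@unit_segment_induction (fun t => hurwitz Q.[t%:P])).
exact: hurwitz_locally_constant szQ axQ.
Qed.

End Hurwitz.

(** * Frequency responses of proper stable transfer functions *)

Section LowestTerms.
Variable R : realType.
Implicit Types (f : {fraction {poly R}}) (a b : {poly R}).

Lemma tf_den_neq0 f : tf_den f != 0.
Proof.
rewrite /tf_den; case: (repr f) => -[p q] /= q0.
by rewrite divp_eq0 negb_or q0 /= negb_or gcdp_eq0 negb_and q0 orbT -leqNgt
  leq_gcdpr.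
Qed.

Lemma coprime_tf f : coprimep (tf_num f) (tf_den f).
Proof.
rewrite /tf_den /tf_num; case: (repr f) => -[p q] /= q0.
by rewrite coprimep_div_gcd // q0 orbT.
Qed.

Lemma tfE f : f = (tf_num f)%:F / (tf_den f)%:F.
Proof.
have d0 : (tf_den f)%:F != 0 by rewrite tofrac_eq0 tf_den_neq0.
apply: (canRL (mulfK d0)); move: d0.
rewrite /tf_den /tf_num -{2}[f]reprK; case: (repr f) => -[p q] /= q0 d0.
have g0 : (gcdp p q)%:F != 0 by rewrite tofrac_eq0 gcdp_eq0 negb_and q0 orbT.
apply: (mulIf g0); rewrite -mulrA -!tofracM !divpK ?dvdp_gcdl ?dvdp_gcdr //.
apply/eqP; rewrite !piE FracField.equivfE /=.
by rewrite !numden_Ratio ?mulf_neq0 ?oner_neq0 // !mulr1 mulrC.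
Qed.

Lemma tofrac_div_eq a b a' b' : b != 0 -> b' != 0 ->
  (a%:F / b%:F == a'%:F / b'%:F) = (a * b' == a' * b).
Proof.
by move=> b0 b'0; rewrite eqr_div ?tofrac_eq0 // -!tofracM tofrac_eq.
Qed.

Lemma tf_cross f a b : b != 0 -> f = a%:F / b%:F -> tf_num f * b = a * tf_den f.
Proof.
move=> b0 fE; apply/eqP; rewrite -tofrac_div_eq ?tf_den_neq0 // -tfE; exact/eqP.
Qed.

(** For nonzero numerators the cross product gives deg a + deg b' = deg a' + deg b, so properness
    does not depend on the chosen fraction. *)
Lemma cross_size a b a' b' : b != 0 -> b' != 0 -> a * b' = a' * b ->
  (size a <= size b)%N -> (size a' <= size b')%N.
Proof.
move=> b0 b'0 E ab; have [->|a'0] := eqVneq a' 0; first by rewrite size_poly0.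
have a0 : a != 0.
  by apply/eqP => a0; move: E; rewrite a0 mul0r => /esym/eqP;
    rewrite mulf_eq0 (negPf a'0) (negPf b0).
have := congr1 (fun p : {poly R} => size p) E; rewrite !size_mul // => sE.
have h1 : (0 < size a)%N by rewrite size_poly_gt0.
have h2 : (0 < size b)%N by rewrite size_poly_gt0.
have h3 : (0 < size a')%N by rewrite size_poly_gt0.
have h4 : (0 < size b')%N by rewrite size_poly_gt0.
move: sE ab h1 h2 h3 h4; move: (size a) (size b) (size a') (size b') =>
  [|x] [|y] [|z] [|u] //.
rewrite !addSn !addnS /= => -[E'] xy _ _ _ _; rewrite !ltnS in xy *.
by rewrite -(leq_add2r y) -E' addnC leq_add2l.
Qed.

(** By Gauss, the reduced denominator divides every denominator, so stability can be read off any
    fraction with a Hurwitz denominator. *)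
Lemma tf_proper_stable f a b : hurwitz b -> (size a <= size b)%N ->
  f = a%:F / b%:F ->
  tf_proper f /\ tf_stable f.
Proof.
move=> hb ab fE; have b0 := hurwitz_neq0 hb; have E := tf_cross b0 fE.
split; first exact: (cross_size b0 (tf_den_neq0 f) (esym E) ab).
have /hurwitz_dvd : tf_den f %| b; last exact.
by rewrite -(Gauss_dvdpr _ (_ :
  coprimep _ (tf_num f))) ?E ?dvdp_mulIr // coprimep_sym coprime_tf.
Qed.

End LowestTerms.

(** * Values on the extended imaginary axis, compatible with ring operations *)

Section FrequencyResponse.
Variable R : realType.
Implicit Types (f g : {fraction {poly R}}) (a b p q : {poly R}) (w : \bar R).

(* [horner_at n w a] is [a(jw)]; at infinity it is the leading part of [a]
   seen as a polynomial of degree at most [n]. *)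
Definition horner_at (n : nat) w a : R[i] :=
  match w with
  | r%:E => (polyC_of_R a).[0 +i* r]
  | +oo%E => (a`_n)%:C
  | -oo%E => 0
  end.

Lemma coefM_top a b n k : (size a <= n.+1)%N -> (size b <= k.+1)%N ->
  (a * b)`_(n + k) = a`_n * b`_k.
Proof.
move=> an bk; have nlt : (n < (n + k).+1)%N by rewrite ltnS leq_addr.
rewrite coefM (bigD1 (Ordinal nlt)) //= addKn big1 ?addr0 // => i /negPf ni.
have [lt_in|le_ni] := ltnP i n.
  rewrite [b`__]nth_default ?mulr0 //; apply: (leq_trans bk).
  by rewrite ltn_subRL ltn_add2r.
rewrite [a`__]nth_default ?mul0r //; apply: (leq_trans an).
by rewrite ltn_neqAle le_ni andbT; apply: contraFneq ni => ni;
  apply/eqP/val_inj.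
Qed.

Lemma horner_atM n k w a b : (size a <= n.+1)%N -> (size b <= k.+1)%N ->
  horner_at (n + k) w (a * b) = horner_at n w a * horner_at k w b.
Proof.
move=> an bk; case: w => [r||] /=; last by rewrite mul0r.
  by rewrite /polyC_of_R rmorphM hornerM.
by rewrite coefM_top // rmorphM.
Qed.

Lemma horner_atD n w a b : horner_at n w (a + b) = horner_at n w a +
  horner_at n w b.
Proof.
case: w => [r||] /=; last by rewrite addr0.
  by rewrite /polyC_of_R rmorphD hornerD.
by rewrite coefD rmorphD.
Qed.

Lemma horner_at_neq0 n w b : hurwitz b -> size b = n.+1 -> (0 <= w)%E ->
  horner_at n w b != 0.
Proof.
move=> hb sb; case: w => [r||] //= _.
  by apply/negP => /hb /=; rewrite ltxx.
by rewrite -(rmorph0 (real_complex R)) (inj_eq (@complexI _)) -[n]/(n.+1.-1)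
  -sb -lead_coefE lead_coef_eq0 hurwitz_neq0.
Qed.

(** A relation that allows any fraction with a Hurwitz denominator: sums and products then need no
    reduction to lowest terms, and finite and infinite frequencies are treated alike. *)
Definition freq_value w f (v : R[i]) := exists n a b,
  [/\ hurwitz b, size b = n.+1, (size a <= n.+1)%N, f = a%:F / b%:F &
      v = horner_at n w a / horner_at n w b].

Section FixedFrequency.
Variable w : \bar R.
Hypothesis w0 : (0 <= w)%E.

Lemma hurwitz_size_mul a b n k : hurwitz a -> hurwitz b ->
  size a = n.+1 -> size b = k.+1 -> size (a * b) = (n + k).+1.
Proof.
move=> ha hb sa sb; rewrite size_mul ?hurwitz_neq0 // sa sb.
by rewrite addnS /= addSn.
Qed.

Lemma size_mul_bound a b n k : (size a <= n.+1)%N -> (size b <= k.+1)%N ->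
  (size (a * b)%R <= (n + k).+1)%N.
Proof.
move=> an bk; apply: (leq_trans (size_polyMleq _ _)).
have -> : (n + k).+1 = (n.+1 + k.+1).-1 by rewrite addSn addnS.
by rewrite -!subn1 leq_sub2r // leq_add.
Qed.

Lemma freq_valueM f g u v : freq_value w f u -> freq_value w g v ->
  freq_value w (f * g) (u * v).
Proof.
move=> [n [a [b [hb sb an -> ->]]]] [k [c [d [hd sd ck -> ->]]]].
exists (n + k)%N, (a * c), (b * d); split.
- exact: hurwitz_mul.
- exact: hurwitz_size_mul.
- exact: size_mul_bound.
- by rewrite !tofracM mulf_div.
- by rewrite !horner_atM ?sb ?sd // mulf_div.
Qed.

Lemma freq_valueD f g u v : freq_value w f u -> freq_value w g v ->
  freq_value w (f + g) (u + v).
Proof.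
move=> [n [a [b [hb sb an -> ->]]]] [k [c [d [hd sd ck -> ->]]]].
have b0 := hurwitz_neq0 hb; have d0 := hurwitz_neq0 hd.
exists (n + k)%N, (a * d + c * b), (b * d); split.
- exact: hurwitz_mul.
- exact: hurwitz_size_mul.
- apply: leq_trans (size_polyD _ _) _; rewrite geq_max size_mul_bound ?sd //=.
  by rewrite addnC size_mul_bound ?sb.
- by rewrite addf_div ?tofrac_eq0 // !(tofracM, tofracD).
- rewrite addf_div ?horner_at_neq0 // horner_atD (horner_atM _ an) ?sd //.
  by rewrite addnC (horner_atM _ ck) ?sb // addnC horner_atM ?sb ?sd.
Qed.

Lemma freq_valueC (c : R) : freq_value w c%:P%:F c%:C.
Proof.
exists 0%N, c%:P, 1; rewrite size_poly1 size_polyC leq_b1 tofrac1 divr1;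
  split => //.
  exact: hurwitz1.
case: w w0 => [r||] //= _; last by rewrite !coefC /= divr1.
by rewrite /polyC_of_R map_polyC rmorph1 /= hornerC hornerE divr1.
Qed.

Lemma freq_value1 : freq_value w 1 1.
Proof. by have := freq_valueC 1; rewrite polyC1 tofrac1. Qed.

Lemma freq_value0 : freq_value w 0 0.
Proof. by have := freq_valueC 0; rewrite polyC0 tofrac0. Qed.

Lemma freq_value_sum (I : Type) (r : seq I) (P : pred I) F G :
  (forall i, P i -> freq_value w (F i) (G i)) ->
  freq_value w (\sum_(i <- r | P i) F i) (\sum_(i <- r | P i) G i).
Proof. by move=> FG; apply: big_ind2 => //; [exact: freq_value0|move=> *;
  exact: freq_valueD]. Qed.

Lemma freq_value_prod (I : Type) (r : seq I) (P : pred I) F G :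
  (forall i, P i -> freq_value w (F i) (G i)) ->
  freq_value w (\prod_(i <- r | P i) F i) (\prod_(i <- r | P i) G i).
Proof. by move=> FG; apply: big_ind2 => //; [exact: freq_value1|move=> *;
  exact: freq_valueM]. Qed.

Lemma freq_value_sign n : freq_value w ((-1) ^+ n) ((-1) ^+ n).
Proof.
have N1 : freq_value w (-1) (-1).
  by have := freq_valueC (-1); rewrite polyCN polyC1 tofracN tofrac1 rmorphN1.
by elim: n => [|n IHn]; [exact: freq_value1|rewrite !exprS; exact: freq_valueM].
Qed.

Definition freq_valuemx (m k : nat) (A : matrix _ m k) (B : matrix _ m k) :
  Prop :=
  forall i j, freq_value w (A i j) (B i j).

Lemma freq_valuemx_mul m k l (A : matrix _ m k) (B : matrix _ k l) A' B' :
  freq_valuemx A A' -> freq_valuemx B B' -> freq_valuemx (A *m B) (A' *m B').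
Proof.
by move=> hA hB i j; rewrite !mxE; apply: freq_value_sum => x _;
  apply: freq_valueM.
Qed.

Lemma freq_valuemx1 m : freq_valuemx (1%:M : 'M[_]_m) 1%:M.
Proof.
move=> i j; rewrite !mxE; case: eqP => _;
  [exact: freq_value1|exact: freq_value0].
Qed.

Lemma freq_valuemx_prod m (I : Type) (r : seq I) (F G : I -> 'M[_]_m) :
  (forall i, freq_valuemx (F i) (G i)) ->
  freq_valuemx (\prod_(i <- r) F i) (\prod_(i <- r) G i).
Proof.
move=> FG; apply: (big_ind2 (fun A B => freq_valuemx A B)) => //.
  exact: freq_valuemx1.
by move=> *; apply: freq_valuemx_mul.
Qed.

Lemma freq_value_det m (A : 'M[_]_m) A' : freq_valuemx A A' ->
  freq_value w (\det A) (\det A').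
Proof.
move=> hA; apply: freq_value_sum => s _; apply: freq_valueM;
  first exact: freq_value_sign.
exact: freq_value_prod.
Qed.

Lemma freq_valuemx_adj m (A : 'M[_]_m) A' : freq_valuemx A A' ->
  freq_valuemx (\adj A) (\adj A').
Proof.
move=> hA i j; rewrite !mxE; apply: freq_valueM; first exact: freq_value_sign.
by apply: freq_value_det => x y; rewrite !mxE.
Qed.

(** Cross-multiplication shows that the value does not depend on the fraction; this carries
    nonvanishing of a value over to a chosen numerator. *)
Lemma freq_value_uniq f v p q k : freq_value w f v -> hurwitz q ->
  size q = k.+1 ->
  f = p%:F / q%:F ->
  (size p <= k.+1)%N /\ v = horner_at k w p / horner_at k w q.
Proof.
move=> [n [a [b [hb sb an fE ->]]]] hq sq fE'.
have b0 := hurwitz_neq0 hb; have q0 := hurwitz_neq0 hq.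
have /eqP : a%:F / b%:F == p%:F / q%:F by rewrite -fE fE'.
move/eqP; rewrite tofrac_div_eq // => /eqP E.
have pk : (size p <= k.+1)%N by rewrite -sq (cross_size b0 q0 E) // sb.
split => //; apply/eqP; rewrite eqr_div ?horner_at_neq0 //.
by rewrite -horner_atM ?sq // E addnC horner_atM ?sb.
Qed.

End FixedFrequency.

(** Write a = c b + r with r of smaller degree than b; then r / b is O(1 / (1 + x)) by
    [hurwitz_lower]. *)
Lemma tf_eval_oo_lim a b n : hurwitz b -> size b = n.+1 -> (size a <= n.+1)%N ->
  ((polyC_of_R a).[0 +i* x] / (polyC_of_R b).[0 +i* x] : R[i]^o) @[x --> +oo%R]
    --> ((a`_n)%:C / (b`_n)%:C : R[i]^o).
Proof.
move=> hb sb an; set c := a`_n / b`_n.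
have bn0 : b`_n != 0 by rewrite -[n]/(n.+1.-1) -sb -lead_coefE lead_coef_eq0
  hurwitz_neq0.
have [K K0 hK] := hurwitz_lower hb; rewrite sb /= in hK.
pose r := a - c *: b.
have rn : (size r <= n)%N.
  apply/leq_sizeP => j; rewrite leq_eqVlt => /predU1P[<-|nj].
    by rewrite coefB coefZ /c divfK // subrr.
  by rewrite coefB coefZ !nth_default ?mulr0 ?subrr // ?sb // (leq_trans an).
(* The spare degree of [r] pays for the extra factor 1 + |s|; for n = 0 the remainder vanishes. *)
have [M M0 hM] : exists2 M : R, 0 <= M & forall s,
    normc (polyC_of_R r).[s] * (1 + normc s) <= M * (1 + normc s) ^+ n.
  have [n0|npos] := posnP n.
    exists 0 => // s; move: rn; rewrite n0 leqn0 size_poly_eq0 => /eqP ->.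
    by rewrite /polyC_of_R rmorph0 horner0 normc0 mul0r mul0r.
  exists (\sum_(i < n) `|r`_i|) => [|s]; first by rewrite sumr_ge0.
  have := @horner_upper R r n.-1 s; rewrite prednK // => /(_ rn) h.
  have -> : (1 + normc s) ^+ n = (1 + normc s) ^+ n.-1 * (1 + normc s).
    by rewrite -exprSr prednK.
  by rewrite mulrA ler_wpM2r // addr_ge0 ?normc_ge0.
apply/cvgrPdist_lt => e e0.
(* The radius is a positive element of the complex field, hence real. *)
have [d dE] : exists d : R, e = d%:C.
  by exists (complex.Re e); rewrite RRe_real // gtr0_real.
move: e0; rewrite dE ltcR => d0.
near=> x.
have x0 : 0 <= x by near: x; apply: nbhs_pinfty_ge; rewrite num_real.
have xM : M / (K * d) < x by near: x; apply: nbhs_pinfty_gt; rewrite num_real.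
set s := 0 +i* x.
have sx : normc s = x by rewrite /s /= expr0n add0r sqrtr_sqr ger0_norm.
have s0 : 0 <= complex.Re s by [].
have bs := hK s s0.
have p0 : 0 < (1 + normc s) ^+ n by rewrite exprn_gt0 // sx ltr_wpDr.
have bs0 : 0 < normc (polyC_of_R b).[s] by apply: lt_le_trans bs;
  exact: mulr_gt0.
have bsn0 : (polyC_of_R b).[s] != 0.
  by apply: contraTneq bs0 => ->; rewrite normc0 ltxx.
have -> : (a`_n)%:C / (b`_n)%:C - (polyC_of_R a).[s] / (polyC_of_R b).[s] =
    - ((polyC_of_R r).[s] / (polyC_of_R b).[s]).
  have -> : (polyC_of_R r).[s] = (polyC_of_R a).[s] - c%:C * (polyC_of_R b).[s].
    by rewrite /polyC_of_R rmorphB /= linearZ /= hornerD hornerN hornerZ.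
  by rewrite mulrBl mulfK // opprB /c rmorphM fmorphV.
rewrite normr_normc ltcR normcN normcM normcV ltr_pdivrMr //.
have rs := hM s.
apply: (@lt_le_trans _ _ (d * (K * (1 + normc s) ^+ n)));
  last by rewrite ler_pM2l.
have q0 : 0 < 1 + normc s by rewrite sx ltr_wpDr.
rewrite -(ltr_pM2r q0); apply: (le_lt_trans rs).
rewrite mulrA [ltRHS]mulrAC ltr_pM2r // -ltr_pdivrMl ?mulr_gt0 //.
rewrite mulrC sx (mulrC d); apply: lt_trans xM _; lra.
Unshelve. all: by end_near. Qed.

Lemma freq_value_tf f : tf_proper f -> tf_stable f -> forall w, (0 <= w)%E ->
  freq_value w f (match w with
                  | r%:E => tf_eval f (0 +i* r)
                  | +oo%E => tf_eval_oo f
                  | -oo%E => 0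
                  end).
Proof.
move=> pf sf w w0; have hd : hurwitz (tf_den f) by exact: sf.
have sd : size (tf_den f) = (size (tf_den f)).-1.+1.
  by rewrite prednK // size_poly_gt0 tf_den_neq0.
exists (size (tf_den f)).-1, (tf_num f), (tf_den f); split => //;
  first by rewrite -sd.
  exact: tfE.
case: w w0 => [r||] //= _; rewrite /tf_eval_oo.
by apply: (@cvg_lim R[i]^o); [exact: norm_hausdorff|apply: tf_eval_oo_lim;
  rewrite -?sd].
Qed.

Lemma freq_valuemx_resp m (P : 'M[_]_m) w : RHinf P -> (0 <= w)%E ->
  freq_valuemx w P (freq_resp P w).
Proof.
move=> hP w0 i j; have [pf sf] := hP i j; have := freq_value_tf pf sf w0.
by case: w w0 => [r||] // _; rewrite mxE.
Qed.

(** The product of all reduced denominators is Hurwitz, and each of them divides it. *)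
Lemma common_denominator m (A : 'M[{fraction {poly R}}]_m) : RHinf A ->
  exists d (M : 'M[{poly R}]_m),
    hurwitz d /\ A = (d%:F)^-1 *: map_mx (@FracField.tofrac _) M.
Proof.
move=> hA; pose d := \prod_i \prod_j tf_den (A i j).
have hd : hurwitz d.
  have hprod (F : 'I_m -> {poly R}) : (forall i, hurwitz (F i)) ->
    hurwitz (\prod_i F i).
    by move=> hF; elim/big_rec: _ => [|i p _];
      [exact: hurwitz1|exact: hurwitz_mul].
  by apply: (hprod) => i; apply: (hprod) => j; have [] := hA i j.
have dvd i j : tf_den (A i j) %| d.
  by rewrite /d (bigD1 i) //= (bigD1 j) //= -mulrA dvdp_mulIl.
exists d, (\matrix_(i, j) (tf_num (A i j) * (d %/ tf_den (A i j))));
  split => //.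
apply/matrixP => i j; rewrite !mxE tofracM {1}[A i j]tfE.
have d0 := hurwitz_neq0 hd.
have dE : d%:F = (d %/ tf_den (A i j))%:F * (tf_den (A i j))%:F by rewrite
  -tofracM divpK.
have x0 : (d %/ tf_den (A i j))%:F != 0.
  by apply/eqP => E; move/eqP: dE; rewrite E mul0r tofrac_eq0 (negPf d0).
by rewrite dE [RHS]mulrC invfM mulrA mulfK.
Qed.

End FrequencyResponse.

(** * From nonvanishing determinants to a stable inverse *)

Section Nyquist.
Variable R : realType.

(** A value at any single frequency thus certifies membership in RH-infinity, since it carries a
    proper fraction with a Hurwitz denominator. *)
Lemma freq_value_RH w (f : {fraction {poly R}}) v : freq_value w f v ->
  tf_proper f /\ tf_stable f.
Proof.
by move=> [n [a [b [hb sb an fE _]]]]; apply: (tf_proper_stable hb _ fE);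
  rewrite sb.
Qed.

Variables (m : nat) (L : 'M[{fraction {poly R}}]_m) (V : \bar R -> 'M[R[i]]_m).
Hypothesis LV : forall w, (0 <= w)%E -> freq_valuemx w L (V w).
Hypothesis detV : forall w t, (0 <= w)%E -> 0 <= t <= 1 ->
  \det (1%:M + t%:C *: V w) != 0.

Lemma nyquist_stable : let S := 1%:M + L in S \in unitmx /\ RHinf (invmx S).
Proof.
have e0 : (0 <= 0%:E :> \bar R)%E by [].
have hL : RHinf L by move=> i j; exact: freq_value_RH (LV e0 i j).
have [d [M [hd LE]]] := common_denominator hL.
have d0 := hurwitz_neq0 hd.
(* [Q] is det (d I + t M) with t as outer indeterminate; its value at t is d ^ m det (I + t L). *)
pose Q : {poly {poly R}} :=
  \det (\matrix_(i, j) ((d *+ (i == j))%:P + (M i j)%:P * 'X)).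
have QE t : Q.[t%:P] = \det (d%:M + t%:P *: M).
  rewrite /Q -/(horner_eval t%:P _) -det_map_mx; congr (\det _).
  apply/matrixP => i j; rewrite !mxE /= /horner_eval.
  by rewrite hornerD hornerM !hornerC hornerX mulrC.
have QF t : \det (1%:M + t%:P%:F *: L) = Q.[t%:P]%:F / (d ^+ m)%:F.
  apply: (canRL (mulfK _)); first by rewrite tofrac_eq0 expf_neq0.
  rewrite QE -det_map_mx rmorphXn /= mulrC -detZ; congr (\det _).
  rewrite map_mxD map_scalar_mx map_mxZ LE scalerDr scalemx1 !scalerA.
  by rewrite [_ * _ * _]mulrAC mulfV ?tofrac_eq0 // mul1r.
have hdm : hurwitz (d ^+ m).
  by elim: m => [|k IHk]; rewrite ?expr0 ?exprS;
    [exact: hurwitz1|exact: hurwitz_mul].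
have dm0 := hurwitz_neq0 hdm.
pose k := (size (d ^+ m)).-1.
have sdm : size (d ^+ m) = k.+1 by rewrite prednK // size_poly_gt0.
have val w t : (0 <= w)%E -> 0 <= t <= 1 ->
    (size Q.[t%:P] <= k.+1)%N /\ horner_at k w Q.[t%:P] != 0.
  move=> w0 tI.
  have fv : freq_value w (\det (1%:M + t%:P%:F *: L)) (\det (1%:M +
    t%:C *: V w)).
    apply: freq_value_det => // i j; rewrite !mxE; apply: freq_valueD => //.
      by have := freq_valuemx1 w0 i j; rewrite !mxE.
    by apply: freq_valueM => //; [exact: freq_valueC|exact: LV].
  have [sQ vE] := freq_value_uniq w0 fv hdm sdm (QF t).
  split => //; have := detV w0 tI; rewrite vE; apply: contraNneq => ->.
  by rewrite mul0r.
(* At infinity, nonvanishing says that the coefficient of degree [k] is nonzero, so the degree is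
   exactly [k]. *)
have sizeQ t : 0 <= t <= 1 -> size Q.[t%:P] = k.+1.
  move=> tI; have [sQ /= lc] := val +oo%E t (leey _) tI.
  apply/eqP; rewrite eqn_leq sQ ltnNge; apply: contra lc => sQk.
  by rewrite nth_default // rmorph0.
have hQ1 : hurwitz Q.[1%:P].
  apply: (hurwitz_homotopy sizeQ) => [t [a r] tI /= a0|]; last first.
    by rewrite QE polyC0 scale0r addr0 det_scalar.
  (* Only nonnegative frequencies are controlled; the negative ones follow by conjugation, the
     coefficients being real. *)
  rewrite a0; wlog r0 : r {a0} / 0 <= r => [th|].
    have [/th //|/ltW r0] := leP 0 r.
    have := th (- r); rewrite oppr_ge0 => /(_ r0); apply: contra.
    by move=> /root_polyC_of_R_conj.
  by have [_] := val r%:E t r0 tI.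
have SE : \det (1%:M + L) = Q.[1%:P]%:F / (d ^+ m)%:F.
  by rewrite -QF polyC1 tofrac1 scale1r.
have Q1n0 := hurwitz_neq0 hQ1.
have S0 : \det (1%:M + L) != 0.
  by rewrite SE mulf_neq0 ?invr_eq0 ?tofrac_eq0.
split; first by rewrite unitmxE unitfE.
move=> i j; rewrite /invmx unitmxE unitfE S0 mxE.
(* The inverse determinant is d ^ m over the Hurwitz polynomial [Q.[1%:P]] of the same degree, and
   the adjugate is polynomial in the entries. Frequency 0 merely serves to certify membership. *)
have inv : freq_value 0%:E (\det (1%:M +
  L))^-1 (horner_at k 0%:E (d ^+ m) / horner_at k 0%:E Q.[1%:P]).
  exists k, (d ^+ m), Q.[1%:P]; split => //; last by rewrite SE invf_div.
    by rewrite sizeQ // ler01 lexx.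
  by rewrite sdm.
have adj : freq_valuemx 0%:E (\adj (1%:M + L)) (\adj (1%:M + V 0%:E)).
  apply: freq_valuemx_adj => // x y; rewrite !mxE; apply: freq_valueD => //.
    by have := freq_valuemx1 e0 x y; rewrite !mxE.
  exact: LV.
exact: freq_value_RH (freq_valueM inv (adj i j)).
Qed.

End Nyquist.

Theorem theorem6 (R : realType) (m N : nat) (hm : (0 < m)%N) (hN : (0 < N)%N)
  (P : 'I_N -> 'M[{fraction {poly R}}]_m)
  (hP : forall i : 'I_N, RHinf (P i))
  (PP : 'I_N -> \bar R -> set 'M[R[i]]_m)
  (hPP : forall (i : 'I_N) (w : \bar R), (0 <= w)%E ->
     PP i w (freq_resp (P i) w))
  (hSRG : exists theta : 'I_N -> \bar R -> R,
     forall w : \bar R, (0 <= w)%E ->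
       le_minus1 `&` set_prod (fun i : 'I_N => SRG (theta i w) (PP i w)) = set0 /\
       exists J : {set 'I_N}, (N.-1 <= #|J|)%N /\
         forall i : 'I_N, i \in J -> arc_property (theta i w) (PP i w)) :
  feedback_stable P.
Proof.
(* Writing N as [n.+1] turns the bound [N.-1] on the number of arc properties into n. *)
case: N hN P hP PP hPP hSRG => // n _ P hP PP hPP [theta hSRG].
apply: (@nyquist_stable _ _ _ (fun w => \prod_(i < n.+1) freq_resp (P i) w)).
  by move=> w w0; apply: freq_valuemx_prod => // i; exact: freq_valuemx_resp.
move=> w t w0 tI; have [disj [J [Jn arcJ]]] := hSRG w w0.
by apply: (det_return_difference_neq0 _ Jn arcJ disj tI) => i; exact: hPP.
Qed.
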